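(* Let $G$ be a word-hyperbolic group and suppose that $G$ engulfs every finitely generated free subgroup $S$ of $G$ whose limit set $\Lambda(S)$ is a proper subset of $\partial G$. Then $G$ is almost residually finite, i.e. the intersection of all finite index subgroups of $G$ is finite. If $G$ is torsion free, then $G$ is residually finite.
   Context: A finitely generated group $G$ is word-hyperbolic if, with the word metric of a finite generating set, it is a $\delta$-hyperbolic space for some $\delta\ge 0$. Its boundary at infinity $\partial G$ is the (metrisable, compact) space of equivalence classes of rays converging to infinity in the group; it is empty when $G$ is finite. For a subgroup $H\le G$, the limit set $\Lambda(H)\subseteq\partial G$ is the set of points of $\partial G$ that are limits of sequences of elements of $H$ (empty if $H$ is finite). A subgroup $H\le G$ is engulfed (one says $G$ engulfs $H$) if $H$ is contained in a proper finite index subgroup of $G$. A group is almost residually finite if the intersection of all its finite index subgroups is finite, and residually finite if this intersection is trivial. *)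

(* Defs.v *)
From mathcomp Require Import all_boot all_order all_algebra.
From mathcomp Require Import all_classical.

Set Implicit Arguments.
Unset Strict Implicit.
Unset Printing Implicit Defensive.

Local Open Scope classical_set_scope.

(* A word over B is a list of letters (e, x) with x in B, the letter (false, x)
   standing for x and (true, x) for x^-1. *)

Definition letter_val (G : groupType) (l : bool * G) : G :=
  if l.1 then (l.2^-1)%g else l.2.

Definition word_val (G : groupType) (w : seq (bool * G)) : G :=
  (\prod_(l <- w) letter_val l)%g.

Definition word_over (G : groupType) (B : set G) (w : seq (bool * G)) : Prop :=
  forall l, l \in w -> B l.2.

Definition reduced (G : groupType) (w : seq (bool * G)) : bool :=
  sorted (fun a b => ~~ ((a.2 == b.2) && (a.1 != b.1))) w.

Definition subgroup (G : groupType) (H : set G) : Prop :=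
  H 1%g /\ forall x y, H x -> H y -> H (x * y^-1)%g.

Definition gen (G : groupType) (B : set G) : set G :=
  [set g | exists2 w, word_over B w & word_val w = g].

Definition finitely_generated (G : groupType) (H : set G) : Prop :=
  exists2 B, finite_set B & gen B = H.

Definition free_basis (G : groupType) (H B : set G) : Prop :=
  gen B = H /\
  forall w, word_over B w -> reduced w -> word_val w = 1%g -> w = [::].

Definition free_subgroup (G : groupType) (H : set G) : Prop :=
  exists B, free_basis H B.

Definition finite_index (G : groupType) (H : set G) : Prop :=
  finite_set (range (fun g : G => [set (g * h)%g | h in H])).

Definition engulfed (G : groupType) (H : set G) : Prop :=
  exists K : set G,
    [/\ subgroup K, finite_index K, K `<` setT & H `<=` K].

Definition finite_residual (G : groupType) : set G :=
  \bigcap_(K in [set K : set G | subgroup K /\ finite_index K]) K.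

Definition almost_residually_finite (G : groupType) : Prop :=
  finite_set (@finite_residual G).

Definition residually_finite (G : groupType) : Prop :=
  @finite_residual G = [set 1%g].

Definition torsion_free (G : groupType) : Prop :=
  forall (g : G) (n : nat), (0 < n)%N -> (g ^+ n)%g = 1%g -> g = 1%g.

(* The value 0 when g is not in gen S is a dummy: only generating sets S are
   used. *)
Definition word_length (G : groupType) (S : set G) (g : G) : nat :=
  let is_length n :=
    `[< exists w, [/\ word_over S w, word_val w = g & size w = n] >] in
  if pselect (exists n, is_length n) is left e then ex_minn e else 0%N.

Definition word_dist (G : groupType) (S : set G) (g h : G) : nat :=
  word_length S (g^-1 * h)%g.

Definition gromov_product (T : Type) (d : T -> T -> nat) (o x y : T) : rat :=
  (((d x o)%:R + (d y o)%:R - (d x y)%:R) / 2)%R.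

(* As d is integer-valued, it does not matter whether delta is rational or
   real. *)
Definition delta_hyperbolic (T : Type) (d : T -> T -> nat) (delta : rat) : Prop :=
  forall o x y z : T,
    (Num.min (gromov_product d o x y) (gromov_product d o y z) - delta
     <= gromov_product d o x z)%R.

Definition word_hyperbolic (G : groupType) (S : set G) : Prop :=
  [/\ finite_set S, gen S = setT &
      exists2 delta : rat, (0 <= delta)%R & delta_hyperbolic (word_dist S) delta].

(* Rays are geodesic rays of the Cayley graph, given by their vertices, from an
   arbitrary starting vertex. *)
Definition geodesic_ray (G : groupType) (S : set G) (r : nat -> G) : Prop :=
  forall i j, (i <= j)%N -> word_dist S (r i) (r j) = (j - i)%N.

Definition asymptotic (G : groupType) (S : set G) (r s : nat -> G) : Prop :=
  exists C : nat, forall i, (word_dist S (r i) (s i) <= C)%N.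

Definition ray_class (G : groupType) (S : set G) (r : nat -> G) :
    set (nat -> G) :=
  [set s | geodesic_ray S s /\ asymptotic S r s].

(* The points of the boundary are equivalence classes of rays. *)
Definition boundary (G : groupType) (S : set G) : set (set (nat -> G)) :=
  [set ray_class S r | r in geodesic_ray S].

(* u converges to the boundary point xi: (u_m | r_n)_1 tends to infinity with
   m and n, for the rays r of the class xi. *)
Definition converges_to (G : groupType) (S : set G) (u : nat -> G)
    (xi : set (nat -> G)) : Prop :=
  forall r, xi r -> forall M : rat, exists N : nat, forall m n : nat,
    (N <= m)%N -> (N <= n)%N ->
    (M <= gromov_product (word_dist S) 1%g (u m) (r n))%R.

Definition limit_set (G : groupType) (S H : set G) : set (set (nat -> G)) :=
  [set xi | boundary S xi /\
            exists2 u : nat -> G, (forall n, H (u n)) & converges_to S u xi].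

(* Main.v *)
(* Let R be the intersection of the finite index subgroups of G, a normal
   subgroup, and suppose that R is infinite. Then R contains a loxodromic t. If
   every x in G had a conjugate-power relation t^k x = x t^(+-k), a shortest
   element of each coset <t>x would be short, so <t^2> would have finite index and
   t could not lie in R. Hence for some x the quasi-geodesics <t> and x<t> diverge.
   Multiplying the conjugates x g x^-1 of the generators g on both sides by long
   elements of R then gives, by ping-pong, the basis of a free subgroup H whose
   limit set misses an endpoint of t. So H lies in a proper finite index subgroup K.
   But K contains R and H, hence all the x g x^-1, hence G: a contradiction. *)

Require Import Defs.
From mathcomp Require Import all_boot all_order all_algebra.
From mathcomp Require Import all_classical.
From mathcomp Require Import zify lra.

Set Implicit Arguments.
Unset Strict Implicit.
Unset Printing Implicit Defensive.

Local Open Scope classical_set_scope.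
Local Open Scope group_scope.

(* [lia] compares atoms syntactically, whereas rewriting leaves the group
   operations behind various projections of the group structure. *)
Ltac group_lia :=
  intros;
  match goal with G : Group.type |- _ =>
    let canon m c :=
      first [constr_eq m c; fail 1 | progress (change (m) with (c) in * )] in
    let canon_mul M := canon (@monoid.mul M)
      (@monoid.mul (monoid_Group__to__monoid_Magma G)) in
    let canon_inv M := canon (@monoid.inv M)
      (@monoid.inv (monoid_Group__to__monoid_BaseGroup G)) in
    let canon_exp M := canon (@monoid.natexp M)
      (@monoid.natexp (monoid_Group__to__monoid_BaseUMagma G)) in
    repeat match goal with
    | |- context [@monoid.mul ?M] => canon_mul M
    | _ : context [@monoid.mul ?M] |- _ => canon_mul M
    | |- context [@monoid.inv ?M] => canon_inv M
    | _ : context [@monoid.inv ?M] |- _ => canon_inv M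
    | |- context [@monoid.natexp ?M] => canon_exp M
    | _ : context [@monoid.natexp ?M] |- _ => canon_exp M
    end
  end;
  lia.

(** * Integer powers and subgroups *)

Section IntegerPowers.
Variable G : groupType.
Implicit Types (t x y : G) (m n : int).

Definition zpow t m : G :=
  match m with Posz n => t ^+ n | Negz n => t ^- n.+1 end.

Lemma zpowN t m : zpow t (- m)%R = (zpow t m)^-1.
Proof.
case: m => [[|n]|n]; first by rewrite /= invg1.
  by have -> : (- n.+1%:Z)%R = Negz n by lia.
by rewrite NegzE GRing.opprK /= invgK.
Qed.

Lemma zpowS t m : zpow t (m + 1)%R = zpow t m * t.
Proof.
case: m => [n|[|n]].
- have -> : (n%:Z + 1)%R = Posz n.+1 by lia.
  by rewrite /= expgSr.
- by rewrite /= mulVg.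
- have -> : (Negz n.+1 + 1)%R = Negz n by lia.
  by rewrite /= [t ^+ n.+2]expgS invgM mulgVK.
Qed.

Lemma zpowD t m n : zpow t (m + n)%R = zpow t m * zpow t n.
Proof.
elim/int_rect: n => [|n IHn|n IHn].
- by rewrite GRing.addr0 mulg1.
- have -> : (m + n.+1%:Z)%R = ((m + n%:Z) + 1)%R by lia.
  by rewrite zpowS IHn -mulgA -zpowS; congr (_ * zpow _ _); lia.
- have e : (m - n%:Z)%R = ((m - n.+1%:Z) + 1)%R by lia.
  have e' : (- n%:Z)%R = (- n.+1%:Z + 1)%R by lia.
  move: IHn; rewrite e zpowS e' zpowS mulgA; exact: mulIg.
Qed.

Lemma zpowB t m n : zpow t (m - n)%R = zpow t m * (zpow t n)^-1.
Proof. by rewrite zpowD zpowN. Qed.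

(** Reduces integer powers to natural ones: [t^-1] is loxodromic along with [t], so both signs can
    be treated alike. *)
Lemma zpow_sign t m : exists b : bool,
  zpow t m = (if b then t^-1 else t) ^+ absz m.
Proof.
case: m => n; first by exists false.
by exists true; rewrite expVgn.
Qed.

End IntegerPowers.

Section Subgroups.
Variable G : groupType.
Implicit Types (H K B : set G) (w : seq (bool * G)).

Lemma subgroupV H x : subgroup H -> H x -> H x^-1.
Proof. by case=> H1 HB Hx; have := HB _ _ H1 Hx; rewrite mul1g. Qed.

Lemma subgroupM H x y : subgroup H -> H x -> H y -> H (x * y).
Proof.
move=> sH Hx Hy; have /(_ _ _ Hx (subgroupV sH Hy)) := sH.2.
by rewrite invgK.
Qed.

Lemma subgroupX H x n : subgroup H -> H x -> H (x ^+ n).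
Proof.
move=> sH Hx; elim: n => [|n IHn]; first exact: sH.1.
by rewrite expgS; apply: subgroupM.
Qed.

Lemma subgroup_zpow H x m : subgroup H -> H x -> H (zpow x m).
Proof.
move=> sH Hx; case: m => n /=; first exact: subgroupX.
exact: subgroupV (subgroupX _ _ _).
Qed.

Lemma word_val_nil : word_val [::] = 1 :> G.
Proof. by rewrite /word_val big_nil. Qed.

Lemma word_val_cons l w : word_val (l :: w) = letter_val l * word_val w.
Proof. by rewrite /word_val big_cons. Qed.

Lemma word_val_cat w w' : word_val (w ++ w') = word_val w * word_val w'.
Proof. by rewrite /word_val big_cat. Qed.

Definition letter_inv (l : bool * G) := (~~ l.1, l.2).

Lemma letter_valV l : letter_val (letter_inv l) = (letter_val l)^-1.
Proof. by case: l => [] [] x; rewrite /letter_val //= invgK. Qed.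

Definition word_inv w := rev (map letter_inv w).

Lemma word_valV w : word_val (word_inv w) = (word_val w)^-1.
Proof.
elim: w => [|l w IHw]; first by rewrite word_val_nil invg1.
rewrite /word_inv /= rev_cons -cats1 word_val_cat IHw !word_val_cons.
by rewrite word_val_nil mulg1 letter_valV invgM.
Qed.

Lemma word_over_cat B w w' :
  word_over B w -> word_over B w' -> word_over B (w ++ w').
Proof. by move=> h h' l; rewrite mem_cat => /orP[/h|/h']. Qed.

Lemma word_over_inv B w : word_over B w -> word_over B (word_inv w).
Proof. by move=> h l; rewrite mem_rev => /mapP[l' /h ? ->]. Qed.

Lemma word_over_cons B l w :
  word_over B (l :: w) -> B l.2 /\ word_over B w.
Proof.
move=> h; split; first by apply: h; rewrite mem_head.
by move=> l' wl'; apply: h; rewrite inE wl' orbT.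
Qed.

Lemma subgroup_gen B : subgroup (gen B).
Proof.
split; first by exists [::]; rewrite ?word_val_nil.
move=> _ _ [w wB <-] [w' wB' <-]; exists (w ++ word_inv w').
  by apply: word_over_cat => //; apply: word_over_inv.
by rewrite word_val_cat word_valV.
Qed.

Lemma gen_sub B K : subgroup K -> B `<=` K -> gen B `<=` K.
Proof.
move=> sK BK _ [w wB <-]; elim: w wB => [|l w IHw] wB.
  by rewrite word_val_nil; case: sK.
have [Bl /IHw Kw] := word_over_cons wB.
rewrite word_val_cons; apply: subgroupM => //.
by case: l Bl {wB} => [] [] x /BK Kx //; apply: subgroupV.
Qed.

Lemma sub_gen B : B `<=` gen B.
Proof.
move=> x Bx; exists [:: (false, x)]; last first.
  by rewrite word_val_cons word_val_nil mulg1.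
by move=> l; rewrite inE => /eqP->.
Qed.

Lemma subgroup_preconj K y :
  subgroup K -> subgroup [set x | K (y * x * y^-1)].
Proof.
move=> sK; split=> /= [|x x' Kx Kx']; first by rewrite mulg1 mulgV; case: sK.
by have := sK.2 _ _ Kx Kx'; rewrite /= !gnorm.
Qed.

(** The set is [y^-1 K y], whose left cosets are left cosets of [K] translated on the right by
    [y]. *)
Lemma finite_index_preconj K y :
  finite_index K -> finite_index [set x | K (y * x * y^-1)].
Proof.
rewrite /finite_index => fK.
apply: (@sub_finite_set _ _
  ((fun X : set G => [set z | X (z * y^-1)]) @`
   range (fun g : G => [set g * h | h in K]))); last exact: finite_image.
move=> _ [g _ <-]; exists [set (g * y^-1) * h | h in K]; first by exists (g * y^-1).
apply/seteqP; split=> z /=.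
  move=> [h Kh e]; exists (y^-1 * h * y); first by rewrite !gnorm.
  by apply: (@mulIg _ y^-1); rewrite -e !gnorm.
move=> [h Kh <-]; exists (y * h * y^-1) => //; by rewrite !gnorm.
Qed.

Lemma subgroup_finite_residual : subgroup (@finite_residual G).
Proof.
split=> [K [sK _]|x y Rx Ry K [sK fK]]; first by case: sK.
by apply: sK.2; [apply: Rx|apply: Ry].
Qed.

Lemma finite_residual_conj x y :
  @finite_residual G x -> @finite_residual G (y * x * y^-1).
Proof.
move=> Rx K [sK fK]; apply: (Rx [set x | K (y * x * y^-1)]).
by split; [apply: subgroup_preconj | apply: finite_index_preconj].
Qed.

End Subgroups.

(** * Word length *)

Section WordLength.
Variables (G : groupType) (S : set G).
Hypotheses (finS : finite_set S) (genS : gen S = setT).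
Implicit Types (x y g : G) (w : seq (bool * G)).

Lemma word_length_word w : word_over S w ->
  (word_length S (word_val w) <= size w)%N.
Proof.
move=> wS; rewrite /word_length.
case: pselect => [e|//]; case: ex_minnP => n _; apply.
by apply/asboolP; exists w.
Qed.

Lemma word_length_witness g :
  exists w, [/\ word_over S w, word_val w = g & size w = word_length S g].
Proof.
rewrite /word_length; case: pselect => [e|ne].
  by case: ex_minnP => n /asboolP.
have [w wS wg] : gen S g by rewrite genS.
by case: ne; exists (size w); apply/asboolP; exists w.
Qed.

Lemma word_length_eq0 g : word_length S g = 0%N -> g = 1.
Proof.
have [w [_ <- <-]] := word_length_witness g.
by move/size0nil => ->; apply: word_val_nil.
Qed.

Lemma word_lengthM x y :
  (word_length S (x * y) <= word_length S x + word_length S y)%N.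
Proof.
have [w [wS <- <-]] := word_length_witness x.
have [w' [wS' <- <-]] := word_length_witness y.
rewrite -word_val_cat -size_cat; apply: word_length_word.
exact: word_over_cat.
Qed.

Lemma word_lengthV x : word_length S x^-1 = word_length S x.
Proof.
suff le y : (word_length S y^-1 <= word_length S y)%N.
  by apply/eqP; rewrite eqn_leq le -{1}[x]invgK le.
have [w [wS <- <-]] := word_length_witness y.
rewrite -word_valV -(size_map (@letter_inv G)) -size_rev.
by apply: word_length_word; apply: word_over_inv.
Qed.

Lemma word_length_split x n : (n <= word_length S x)%N ->
  exists y, word_length S y = n /\
    word_length S (y^-1 * x) = (word_length S x - n)%N.
Proof.
have [w [wS wx sw]] := word_length_witness x => nw.
have tS : word_over S (take n w) by move=> l /mem_take /wS.
have dS : word_over S (drop n w) by move=> l /mem_drop /wS.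
have e : x = word_val (take n w) * word_val (drop n w).
  by rewrite -word_val_cat cat_take_drop.
exists (word_val (take n w)); rewrite {1}e mulKg.
have := word_length_word tS; have := word_length_word dS.
have := word_lengthM (word_val (take n w)) (word_val (drop n w)).
rewrite -e size_drop size_takel ?sw //; lia.
Qed.

Lemma word_length_ball n :
  exists s : seq G, forall x, (word_length S x <= n)%N -> x \in s.
Proof.
have [s0 Ss0] := (finite_seqP _).1 finS.
elim: n => [|n [s IHn]].
  by exists [:: 1] => x; rewrite leqn0 => /eqP/word_length_eq0->; rewrite inE.
exists (s ++ [seq letter_val (l : bool * G) * y | 
  l <- map (pair true) s0 ++ map (pair false) s0, y <- s]).
move=> x; rewrite mem_cat leq_eqVlt => /orP[/eqP lx|/IHn-> //].
apply/orP; right.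
have [w [wS wx sw]] := word_length_witness x; rewrite lx in sw.
case: w => [//|l w] in wS wx sw *.
have [Sl wS'] := word_over_cons wS.
apply/allpairsP; exists (l, word_val w); rewrite -wx word_val_cons; split=> //=.
  move: Sl; rewrite Ss0 mem_cat; case: l {wS wx sw} => [] [] y ys0.
    by rewrite map_f.
  by rewrite orbC map_f.
apply: IHn; case: sw => <-; exact: word_length_word.
Qed.

End WordLength.

(* Twice the Gromov product based at 1; the truncated subtraction is exact, by
   the triangle inequality. *)
Definition gp (G : groupType) (len : G -> nat) (x y : G) : nat :=
  (len x + len y - len (x^-1 * y)%g)%N.

(** The properties of the word length on which the geometry rests: [len_split] makes the metric
    discretely geodesic, [len_ball] makes it proper, and [gp_minn] is the hyperbolicity inequality
    at base point 1, doubled to stay in [nat]. *)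
Record hyperbolic_length (G : groupType) (len : G -> nat) (D : nat) : Prop := {
  len_eq0 : forall x : G, len x = 0%N -> x = 1;
  lenV : forall x : G, len x^-1 = len x;
  lenM : forall x y : G, (len (x * y)%g <= len x + len y)%N;
  len_split : forall (x : G) n, (n <= len x)%N ->
    exists y, len y = n /\ len (y^-1 * x)%g = (len x - n)%N;
  len_ball : forall n, exists s : seq G, forall x : G, (len x <= n)%N -> x \in s;
  gp_minn : forall x y z : G, (minn (gp len x y) (gp len y z) <= gp len x z + D)%N
}.

Lemma gromov_product_gp (G : groupType) (S : set G) (x y : G) : gen S = setT ->
  (gromov_product (word_dist S) 1%g x y * 2 = (gp (word_length S) x y)%:R)%R.
Proof.
move=> genS; rewrite /gromov_product /word_dist GRing.divfK // !mulg1.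
rewrite !word_lengthV // /gp GRing.natrB ?GRing.natrD //.
by have := word_lengthM genS x^-1 y; rewrite word_lengthV.
Qed.

Lemma word_hyperbolic_length (G : groupType) (S : set G) :
  word_hyperbolic S -> exists D, hyperbolic_length (word_length S) D.
Proof.
move=> [finS genS [delta d0 hyp]].
(* [gp] is twice the Gromov product, so [delta] is doubled too, then rounded up to an integer. *)
pose D := Num.bound (2 * delta)%R; exists D; split=> [x|x|x y|x n|n|x y z].
- exact: word_length_eq0.
- exact: word_lengthV.
- exact: word_lengthM.
- exact: word_length_split.
- exact: word_length_ball.
have hD : (2 * delta <= D%:R)%R.
  by rewrite Order.POrderTheory.ltW // Num.Theory.archi_boundP //
    Num.Theory.mulr_ge0.
rewrite -(Num.Theory.ler_nat rat) GRing.natrD -minEnat Num.Theory.natr_min.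
rewrite -!gromov_product_gp //.
have := hyp 1 x y z.
move: (gromov_product _ _ x y) (gromov_product _ _ y z) => a b.
by case: (Num.Theory.lerP a b); case: (Num.Theory.lerP (a * 2)%R (b * 2)%R); lra.
Qed.

(** * Loxodromic elements and ping-pong *)

Section HyperbolicLength.
Variables (G : groupType) (len : G -> nat) (D : nat).
Hypothesis hl : hyperbolic_length len D.
Implicit Types (x y z t u v p q : G).
Local Notation gp := (gp len).
Local Notation len_eq0 := (len_eq0 hl).
Local Notation lenV := (lenV hl).
Local Notation lenM := (lenM hl).
Local Notation len_split := (len_split hl).
Local Notation len_ball := (len_ball hl).

Lemma gpE x y : (gp x y + len (x^-1 * y) = len x + len y)%N.
Proof. by rewrite /gp subnK // -(lenV x) lenM. Qed.

Lemma gp_hyp x y z : (gp x y <= gp x z + D)%N \/ (gp y z <= gp x z + D)%N.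
Proof. have := gp_minn hl x y z; group_lia. Qed.

Lemma gpC x y : gp x y = gp y x.
Proof. by rewrite /gp addnC -[len (x^-1 * y)]lenV invgM invgK. Qed.

Lemma gp_len x y : (gp x y <= (len x).*2)%N.
Proof.
have := gpE x y; have := lenM x (x^-1 * y); rewrite mulVKg; group_lia.
Qed.

Lemma len1 : len 1 = 0%N.
Proof.
have [y [y0 _]] := len_split (leq0n (len 1)).
by rewrite -(len_eq0 y0).
Qed.

Lemma gpxx x : gp x x = (len x).*2.
Proof. by have := gpE x x; rewrite mulVg len1; group_lia. Qed.

Lemma gp1 x : gp 1 x = 0%N.
Proof. by have := gp_len 1 x; rewrite len1; group_lia. Qed.

(* Measuring [gp] from the other endpoint of the segment from 1 to [x]. *)
Lemma gp_mulV x y : (gp x (x * y) + gp x^-1 y = (len x).*2)%N.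
Proof.
have := gpE x (x * y); have := gpE x^-1 y; rewrite mulKg invgK lenV; group_lia.
Qed.

Lemma len_mulE x y : (gp x^-1 y + len (x * y) = len x + len y)%N.
Proof. by have := gpE x^-1 y; rewrite invgK lenV. Qed.

Lemma len_mull_le x y : (len y <= len (x * y) + len x)%N.
Proof. by have := lenM x^-1 (x * y); rewrite mulKg lenV addnC. Qed.

Lemma gp_mul2l g x y : (gp (g * x) (g * y) <= gp x y + (len g).*2)%N.
Proof.
have := gpE (g * x) (g * y); have := gpE x y.
have := lenM g x; have := lenM g y.
by rewrite invgM -mulgA mulKg; group_lia.
Qed.

Lemma gp_mul2l_ge g x y : (gp x y <= gp (g * x) (g * y) + (len g).*2)%N.
Proof. by have := gp_mul2l g^-1 (g * x) (g * y); rewrite !mulKg lenV. Qed.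

Lemma gp_mulr x y a : (gp (x * a) y <= gp x y + (len a).*2)%N.
Proof.
have := gpE (x * a) y; have := gpE x y; have := lenM x a.
have := len_mull_le a^-1 (x^-1 * y); rewrite invgM -mulgA lenV; group_lia.
Qed.

(* A chain of long segments with small Gromov products at the corners goes off
   in the direction of its first segment. *)
Lemma chain_gp c x (s : seq G) :
  (forall y, y \in x :: s -> (c + D < len y)%N) ->
  path (fun y z => gp y^-1 z <= c)%N x s ->
  ((len x).*2 <= gp x (\prod_(y <- x :: s) y) + c + D)%N.
Proof.
elim: s x => [|y s IHs] x long; first by rewrite big_seq1 gpxx; group_lia.
move=> /= /andP[xy ys].
have {}IHs : ((len y).*2 <= gp y (\prod_(y0 <- y :: s) y0) + c + D)%N.
  by apply: IHs => // z zs; apply: long; rewrite inE zs orbT.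
rewrite big_cons; set w := \prod_(_ <- _) _ in IHs *.
have ly : (c + D < len y)%N by apply: long; rewrite !inE eqxx orbT.
(* By induction the tail [w] follows [y] for more than [c + D], while [x^-1] leaves [y] within [c];
   hence [gp x^-1 w <= c + D], and [gp_mulV] converts this. *)
have := gp_mulV x w.
case: (gp_hyp x^-1 w y); rewrite ?[gp w y]gpC; group_lia.
Qed.

Lemma chain_neq1 c x (s : seq G) :
  (forall y, y \in x :: s -> (c + D < len y)%N) ->
  path (fun y z => gp y^-1 z <= c)%N x s ->
  \prod_(y <- x :: s) y <> 1.
Proof.
move=> long xs e; have := chain_gp long xs; rewrite e gpC gp1.
have := long x (mem_head _ _); group_lia.
Qed.

(** * Powers of a loxodromic element *)

Section Loxodromic.
Variable t : G.
(* The corners of the path 1, t, t^2, ... are wide compared with its steps. *)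
Hypothesis lox : (gp t^-1 t + 3 * D < len t)%N.

Lemma lox_len_gt0 : (0 < len t)%N. Proof. group_lia. Qed.

Lemma lox_chain n : ((len t).*2 <= gp t (t ^+ n.+1) + gp t^-1 t + D)%N.
Proof.
have -> : t ^+ n.+1 = \prod_(y <- t :: nseq n t) y.
  by rewrite big_cons big_nseq iter_mulg mulg1 expgS.
apply: chain_gp.
  move=> y; rewrite -[_ :: _]/(nseq n.+1 t) mem_nseq => /andP[_ /eqP->]; group_lia.
by elim: n => //= n ->; rewrite leqnn.
Qed.

Lemma lox_gpV1 n : (gp t^-1 (t ^+ n) <= gp t^-1 t + D)%N.
Proof.
case: n => [|n]; first by rewrite expg0 gpC gp1.
have := lox_chain n; rewrite gpC.
case: (gp_hyp t^-1 (t ^+ n.+1) t); group_lia.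
Qed.

Lemma lox_lenS n : (len (t ^+ n) < len (t ^+ n.+1))%N.
Proof. rewrite expgS; have := len_mulE t (t ^+ n); have := lox_gpV1 n; group_lia. Qed.

Lemma lox_len n : (n <= len (t ^+ n))%N.
Proof. by elim: n => // n; have := lox_lenS n; group_lia. Qed.

End Loxodromic.

Lemma lox_inv t : (gp t^-1 t + 3 * D < len t)%N ->
  (gp t^-1^-1 t^-1 + 3 * D < len t^-1)%N.
Proof. by rewrite invgK gpC lenV. Qed.

Section Loxodromic2.
Variable t : G.
Hypothesis lox : (gp t^-1 t + 3 * D < len t)%N.

Lemma lox_gpV m n : (gp (t ^- m) (t ^+ n) <= gp t^-1 t + 2 * D)%N.
Proof.
case: m => [|m].
  by rewrite expg0 invg1 gp1.
have := lox_chain (lox_inv lox) m; rewrite lenV expVgn invgK [gp t t^-1]gpC => h.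
case: (gp_hyp t^-1 (t ^- m.+1) (t ^+ n)); have := lox_gpV1 lox n; group_lia.
Qed.

(** Seen from [t ^+ m], the way back to 1 and the way on to [t ^+ n] are [t ^- m] and
    [t ^+ (n - m)], which diverge by [lox_gpV]. *)
Lemma lox_gp m n : (m <= n)%N ->
  ((len (t ^+ m)).*2 <= gp (t ^+ m) (t ^+ n) + gp t^-1 t + 2 * D)%N.
Proof.
move=> /subnKC<-; rewrite expgnDr.
have := gp_mulV (t ^+ m) (t ^+ (n - m)); have := lox_gpV m (n - m); group_lia.
Qed.

Lemma lox_expg_inj m n : t ^+ m = t ^+ n -> m = n.
Proof.
have h k l : t ^+ k = t ^+ (k + l) -> l = 0%N.
  rewrite expgnDr -{1}[t ^+ k]mulg1 => /mulgI e.
  by have := lox_len lox l; rewrite -e len1; group_lia.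
move=> e; case: (leqP m n) => mn.
  by move: e; rewrite -(subnKC mn) => /h; group_lia.
by move: e; rewrite -(subnKC (ltnW mn)) => /esym/h; group_lia.
Qed.

End Loxodromic2.

(** A non-loxodromic element starts in nearly the same direction as its inverse. If [u] is much
    shorter than [v], the triangle inequality suffices. Otherwise [u * v] being non-loxodromic
    forces [u] and [v] to start together, so [q] is almost a prefix of both [u] and [u^-1].
    Conjugating by [q] then cancels at both ends and saves at least [2 * len q - 3 * D], which is
    positive. *)
Lemma conj_shrink u v q :
  (len u <= gp u^-1 u + 3 * D)%N -> (len v <= gp v^-1 v + 3 * D)%N ->
  (len (u * v) <= gp (u * v)^-1 (u * v) + 3 * D)%N ->
  len q = (2 * D + 1)%N -> len (q^-1 * v) = (len v - len q)%N ->
  (len u <= len v)%N -> (16 * D + 8 <= len v)%N ->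
  (len (q^-1 * u * q) < len v)%N.
Proof.
move=> nu nv nuv lq lqv luv lv.
have lc : (len (q^-1 * u * q) <= len u + (len q).*2)%N.
  have := lenM (q^-1 * u) q; have := lenM q^-1 u; rewrite lenV; group_lia.
case: (ltnP (len u + (len q).*2) (len v)) => [|lu]; first by group_lia.
(* If [u] and [v] diverged early, little would cancel in [u * v]: it would start like [u] and its
   inverse like [v^-1], so it would be loxodromic. *)
have guv : (len v <= gp u v + 2 * len q + 7 * D)%N.
  rewrite leqNgt; apply/negP => small.
  have uVv : (gp u^-1 v <= gp u v + D)%N.
    have := gp_hyp u u^-1 v; rewrite [gp u u^-1]gpC; group_lia.
  have vVu : (gp v^-1 u <= gp u v + D)%N.
    have := gp_hyp u v^-1 v; rewrite [gp u v^-1]gpC; group_lia.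
  have := len_mulE u v; have e1 := gp_mulV u v.
  have e2 : (gp v^-1 (u * v)^-1 + gp u^-1 v = (len v).*2)%N.
    by have := gp_mulV v^-1 u^-1; rewrite -invgM invgK lenV [gp v _]gpC.
  have yu : (gp (u * v)^-1 u <= gp u v + 2 * D)%N.
    have := gp_hyp v^-1 (u * v)^-1 u; group_lia.
  have := gp_hyp (u * v)^-1 (u * v) u; rewrite [gp (u * v) u]gpC; group_lia.
have guVv : (len v <= gp u^-1 v + 2 * len q + 8 * D)%N.
  have := gp_hyp u^-1 u v; group_lia.
have qv := gpE q v.
have qu : ((len q).*2 <= gp q u + D)%N.
  have := gp_hyp q v u; rewrite [gp v u]gpC; group_lia.
have quV : ((len q).*2 <= gp u^-1 q + D)%N.
  have := gp_hyp q v u^-1; rewrite [gp v _]gpC [gp q u^-1]gpC; group_lia.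
have luq := len_mulE u q.
have uqu := gp_mulV u q.
have := gp_hyp q u (u * q); have := gpE q (u * q).
rewrite mulgA; group_lia.
Qed.

(* Otherwise any finitely many elements of [R] become short after conjugation by
   the same [p], chosen to minimise the largest of their lengths, and there are
   only boundedly many short elements. *)
Lemma exists_lox (R : set G) : subgroup R ->
  (forall x y, R x -> R (y * x * y^-1)) -> infinite_set R ->
  exists2 t, R t & (gp t^-1 t + 3 * D < len t)%N.
Proof.
move=> sR nR infR; apply: contrapT => nolox.
have nl x : R x -> (len x <= gp x^-1 x + 3 * D)%N.
  by move=> Rx; rewrite leqNgt; apply/negP => lx; apply: nolox; exists x.
have [ball ballP] := len_ball (16 * D + 8).
have [us usR [uniq_us size_us]] : exists2 us : seq G, forall u, u \in us -> R u &
    uniq us /\ (size ball < size us)%N.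
  have [us usR size_us] := infinite_set_fset (size ball).+1 infR.
  by exists (finmap.enum_fset us) => //; split=> //; apply: finmap.fset_uniq.
have nRp p x : R x -> R (p^-1 * x * p).
  by move=> Rx; have := nR x p^-1 Rx; rewrite invgK.
pose P n := `[< exists p, forall u, u \in us -> (len (p^-1 * u * p) <= n)%N >].
have exP : exists n, P n.
  exists (\max_(u <- us) len u); apply/asboolP; exists 1 => u uus.
  by rewrite invg1 mul1g mulg1; apply: leq_bigmax_seq.
case: (ex_minnP exP) => n /asboolP[p pn] minn.
case: (leqP n (16 * D + 8)) => [nK|Kn].
  have injp : injective (fun u : G => p^-1 * u * p).
    by move=> u v /mulIg/mulgI.
  suff : (size us <= size ball)%N by rewrite leqNgt size_us.
  rewrite -(size_map (fun u : G => p^-1 * u * p)); apply: uniq_leq_size.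
    by rewrite map_inj_uniq.
  by move=> _ /mapP[u uus ->]; apply/ballP/(leq_trans (pn _ uus)).
have [u [uus lu]] : exists u, u \in us /\ len (p^-1 * u * p) = n.
  apply: contrapT => no; have /minn : P n.-1.
    apply/asboolP; exists p => u uus; have := pn u uus.
    rewrite leq_eqVlt => /orP[/eqP e|]; last by group_lia.
    by case: no; exists u.
  group_lia.
(* Conjugating further by an initial segment [q] of the longest conjugate brings every conjugate
   below [n], against minimality. *)
have [q [lq lqu]] : exists q, len q = (2 * D + 1)%N /\
    len (q^-1 * (p^-1 * u * p)) = (len (p^-1 * u * p) - (2 * D + 1))%N.
  by apply: len_split; group_lia.
suff /minn : P n.-1 by group_lia.
apply/asboolP; exists (p * q) => v vus.
have Rv : R (p^-1 * v * p) by apply/nRp/usR.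
have Ru : R (p^-1 * u * p) by apply/nRp/usR.
have := @conj_shrink (p^-1 * v * p) (p^-1 * u * p) q (nl _ Rv) (nl _ Ru).
rewrite lq lqu => /(_ (nl _ (subgroupM sR Rv Ru)) erefl erefl).
have := pn v vus; rewrite lu => ln /(_ ln (ltnW Kn)).
by rewrite !gnorm; group_lia.
Qed.

(** * Elements that commensurate a loxodromic element *)

Lemma len_expg t n : (len (t ^+ n) <= n * len t)%N.
Proof.
elim: n => [|n IHn]; first by rewrite expg0 len1.
by rewrite expgS; have := lenM t (t ^+ n); group_lia.
Qed.

Lemma len_expgV t n : len (t^-1 ^+ n) = len (t ^+ n).
Proof. by rewrite expVgn lenV. Qed.

Section Commensuration.
Variable t : G.
Hypothesis lox : (gp t^-1 t + 3 * D < len t)%N.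

Lemma lox_gp_sign (b : bool) m n : (m <= n)%N ->
  ((len (t ^+ m)).*2 <=
   gp ((if b then t^-1 else t) ^+ m) ((if b then t^-1 else t) ^+ n) +
   gp t^-1 t + 2 * D)%N.
Proof.
move=> mn; case: b; last exact: lox_gp.
have := lox_gp (lox_inv lox) mn.
by rewrite len_expgV invgK [gp t t^-1]gpC.
Qed.

(* If the quasi-axes of [t] and of [x t x^-1] run together for long enough, then
   by the pigeonhole principle [t1^-i x t2^i] takes the same value twice. *)
Lemma lox_commensurate x :
  (forall C : nat, exists m n, (C < gp (zpow t m) (x * zpow t n))%N) ->
  exists (b1 b2 : bool) k, (0 < k)%N /\
    (if b1 then t^-1 else t) ^+ k * x = x * (if b2 then t^-1 else t) ^+ k.
Proof.
move=> far.
have [ball ballP] := len_ball (gp t^-1 t + 3 * len x + 4 * D).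
pose I := size ball.
(* The overlap is long enough to force [I < m] and [I < n], so that the [I + 1] exponents from 0 to
   [I] are available against a ball of [I] elements. *)
have [m [n]] := far (2 * len x + 2 * (I * len t))%N.
have [b1 ->] := zpow_sign t m; have [b2 ->] := zpow_sign t n.
move: (absz m) (absz n) => {}m {}n; set t1 := if b1 then _ else _.
set t2 := if b2 then _ else _; move=> long; exists b1, b2; rewrite -/t1 -/t2.
have l1 i : len (t1 ^+ i) = len (t ^+ i).
  by rewrite /t1; case: (b1); rewrite ?len_expgV.
have l2 i : len (t2 ^+ i) = len (t ^+ i).
  by rewrite /t2; case: (b2); rewrite ?len_expgV.
have lt := lox_len_gt0 lox.
have Im : (I < m)%N.
  have := gp_len (t1 ^+ m) (x * t2 ^+ n); rewrite l1.
  have := len_expg t m; have : (m <= I)%N -> (m * len t <= I * len t)%N.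
    by rewrite leq_mul2r => ->; rewrite orbT.
  group_lia.
have In : (I < n)%N.
  have := gp_len (x * t2 ^+ n) (t1 ^+ m); rewrite gpC.
  have := lenM x (t2 ^+ n); rewrite l2.
  have := len_expg t n; have : (n <= I)%N -> (n * len t <= I * len t)%N.
    by rewrite leq_mul2r => ->; rewrite orbT.
  group_lia.
pose f i := t1 ^- i * x * t2 ^+ i.
(* Both [t1 ^+ i] and [x * t2 ^+ i] lie near the common stretch, at distances from 1 that differ by
   at most [len x]; hence they are close. *)
have fb i : (i <= I)%N -> f i \in ball.
  move=> iI; apply: ballP.
  have lti : (len (t ^+ i) <= I * len t)%N.
    by apply: leq_trans (len_expg t i) _; rewrite leq_mul2r iI orbT.
  have := lox_gp_sign b1 (ltnW (leq_ltn_trans iI Im)); rewrite -/t1 => g1.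
  have := lox_gp_sign b2 (ltnW (leq_ltn_trans iI In)); rewrite -/t2 => g2.
  have := gp_mul2l_ge x (t2 ^+ i) (t2 ^+ n).
  have := gp_hyp (t1 ^+ i) (t1 ^+ m) (x * t2 ^+ n).
  have := gp_hyp (t1 ^+ i) (x * t2 ^+ n) (x * t2 ^+ i).
  rewrite [gp (x * t2 ^+ n) _]gpC.
  have := gpE (t1 ^+ i) (x * t2 ^+ i); rewrite l1 /f -mulgA.
  have := lenM x (t2 ^+ i); rewrite l2; group_lia.
have : ~~ uniq (map f (iota 0 I.+1)).
  apply/negP => fu; have : (size (map f (iota 0 I.+1)) <= I)%N.
    apply: uniq_leq_size => // z /mapP[i]; rewrite mem_iota => iI ->.
    by apply: fb; group_lia.
  by rewrite size_map size_iota ltnn.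
move/(uniqPn 1) => [i [j [ij]]]; rewrite size_map size_iota => jI.
rewrite !(nth_map 0%N) ?size_iota ?(ltn_trans ij jI) //.
rewrite !nth_iota ?(ltn_trans ij jI) // !add0n /f => e.
exists (j - i)%N; split; first by rewrite subn_gt0.
apply: (@mulIg _ (t2 ^+ i)); rewrite -[RHS]mulgA -expgnDr subnK ?(ltnW ij) //.
have -> : x * t2 ^+ j = t1 ^+ j * (t1 ^- j * x * t2 ^+ j).
  by rewrite -!mulgA mulVKg.
by rewrite -e -{2}(subnK (ltnW ij)) expgnDr -!mulgA mulVKg.
Qed.

(** If [x] followed the powers of [t] further, it would pass close to [t1 ^+ i], and [t1 ^- i * x]
    would be a shorter element of the coset. *)
Lemma lox_minimal_gp x m : (forall n, (len x <= len (zpow t n * x))%N) ->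
  (gp x (zpow t m) <= 2 * ((gp t^-1 t + 3 * D + 1) * len t))%N.
Proof.
move=> xmin; have [b e] := zpow_sign t m; rewrite {}e.
move: (absz m) => {}m; set t1 := if b then _ else _.
move ei: (gp t^-1 t + 3 * D + 1)%N => i.
have l1 j : len (t1 ^+ j) = len (t ^+ j).
  by rewrite /t1; case: (b); rewrite ?len_expgV.
case: (leqP m i) => [mi|/ltnW im].
  have := gp_len (t1 ^+ m) x; rewrite gpC l1; have := len_expg t m.
  have : (m * len t <= i * len t)%N by rewrite leq_mul2r mi orbT.
  group_lia.
have := lox_gp_sign b im; rewrite -/t1; have := lox_len lox i; have := len_expg t i.
have := gp_hyp (t1 ^+ i) (t1 ^+ m) x; rewrite [gp (t1 ^+ m) x]gpC.
have : (len x <= len (t1 ^- i * x))%N.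
  rewrite /t1; case: (b); first by have := xmin (Posz i); rewrite expVgn invgK.
  by have := xmin (- Posz i)%R; rewrite zpowN.
have := gpE (t1 ^+ i) x; rewrite l1; group_lia.
Qed.

(** For a long power [y] of [t] with [y * x = x * y'], the conjugate [x^-1 * y * x] is no longer
    than [y]. But [x] diverges from both [y] and [y^-1], so a long [x] would make this conjugate
    longer than [y]. *)
Lemma lox_minimal_len x b1 b2 k : (forall n, (len x <= len (zpow t n * x))%N) ->
  (0 < k)%N ->
  (if b1 then t^-1 else t) ^+ k * x = x * (if b2 then t^-1 else t) ^+ k ->
  (len x <= 2 * ((gp t^-1 t + 3 * D + 1) * len t) + D)%N.
Proof.
move=> xmin k0; set e := (2 * _)%N => comm.
have small m : (gp x (zpow t m) <= e)%N by apply: lox_minimal_gp.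
set t1 := if b1 then _ else _ in comm; set t2 := if b2 then _ else _ in comm.
(* The factor [e + D + 1] makes [y] long enough that [y * x] must follow [y] beyond [e + D]. *)
pose y := t1 ^+ (k * (e + D + 1)).
have comm_y : y * x = x * t2 ^+ (k * (e + D + 1)).
  rewrite /y !expgnA; elim: (e + D + 1)%N => [|l IHl].
    by rewrite !expg0 mul1g mulg1.
  by rewrite expgSr -mulgA comm mulgA IHl -mulgA -expgSr.
have l1 j : len (t1 ^+ j) = len (t ^+ j).
  by rewrite /t1; case: (b1); rewrite ?len_expgV.
have l2 j : len (t2 ^+ j) = len (t ^+ j).
  by rewrite /t2; case: (b2); rewrite ?len_expgV.
have ly : (e + D + 1 <= len y)%N.
  rewrite l1; apply: leq_trans (lox_len lox _).
  by rewrite -{1}[(e + D + 1)%N]mul1n leq_mul2r k0 orbT.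
have [m ym] : exists m, y = zpow t m.
  rewrite /y /t1; case: (b1); last by exists (Posz (k * (e + D + 1))).
  by exists (- Posz (k * (e + D + 1)))%R; rewrite zpowN expVgn.
have xy : (gp x y <= e)%N by rewrite ym.
have xyV : (gp x y^-1 <= e)%N by rewrite ym -zpowN.
have := gp_mulV y x; have := len_mulE y x; rewrite [gp y^-1 x]gpC.
have := gp_hyp y (y * x) x; rewrite [gp y x]gpC [gp (y * x) x]gpC.
have := gpE x (y * x); rewrite {2}comm_y mulKg l2 -(l1 (k * _)%N) -/y; group_lia.
Qed.

Lemma lox_independent_or_cofinite :
  (exists x C, forall m n, (gp (zpow t m) (x * zpow t n) <= C)%N) \/
  (exists ys : seq G, forall g, exists m y, y \in ys /\ g = zpow t m * y).
Proof.
case: (pselect (exists x C, forall m n, (gp (zpow t m) (x * zpow t n) <= C)%N)).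
  by left.
move=> dep; right.
have [ys ysP] := len_ball (2 * ((gp t^-1 t + 3 * D + 1) * len t) + D).
exists ys => g.
have exP : exists n, `[< exists m, len (zpow t m * g) = n >].
  by exists (len (zpow t 0 * g)); apply/asboolP; exists 0%R.
case: (ex_minnP exP) => n /asboolP[m ln] minn.
have gmin k : (len (zpow t m * g) <= len (zpow t k * (zpow t m * g)))%N.
  by rewrite ln mulgA -zpowD; apply: minn; apply/asboolP; exists (k + m)%R.
exists (- m)%R, (zpow t m * g); rewrite zpowN mulKg; split=> //.
have [C|b1 [b2 [k [k0 comm]]]] := @lox_commensurate (zpow t m * g).
  apply: contrapT => le; apply: dep; exists (zpow t m * g), C => k l.
  by rewrite leqNgt; apply/negP => lt; apply: le; exists k, l.
exact/ysP/(lox_minimal_len gmin k0 comm).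
Qed.

End Commensuration.

(** * Geodesic rays as limits of geodesic segments *)

Lemma gp_prefix u z y :
  (len u + len (u^-1 * z))%N = len z -> (gp u y <= gp z y)%N.
Proof.
move=> uz; have := gpE u y; have := gpE z y.
have := lenM (u^-1 * z)^-1 (u^-1 * y).
rewrite lenV invgM invgK -mulgA mulVKg.
group_lia.
Qed.

(** König's lemma: an element on geodesics from 1 to infinitely many [z m] has, since balls are
    finite, a neighbour one step further out with the same property. *)
Lemma geodesic_limit (z : nat -> G) : (forall n, n <= len (z n))%N ->
  exists r : nat -> G,
    (forall i j, (i <= j)%N -> len ((r i)^-1 * r j) = (j - i)%N) /\
    forall i, exists m, (len (r i) + len ((r i)^-1 * z m))%N = len (z m).
Proof.
move=> zlong.
pose prefix v m := (len v + len (v^-1 * z m))%N = len (z m).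
pose P v := forall N, exists2 m, (N <= m)%N & prefix v m.
have P1 : P 1 by move=> N; exists N; rewrite // /prefix len1 invg1 mul1g.
have [ball ballP] := len_ball 1.
(* The existential stands before [P v] so that choice gives a total function; 1 is a dummy where
   [P v] fails. *)
have step v : exists v', P v ->
    [/\ P v', len (v^-1 * v') = 1%N & len v' = (len v).+1].
  have [Pv|] := pselect (P v); last by exists 1.
  suff [v' ?] : exists v',
      [/\ P v', len (v^-1 * v') = 1%N & len v' = (len v).+1].
    by exists v'.
  apply: contrapT => no.
  have /choice[N Nq] : forall q, exists N, forall m, (N <= m)%N ->
      len q = 1%N -> len (v * q) = (len v).+1 -> ~ prefix (v * q) m.
    move=> q; apply: contrapT => noN; apply: no; exists (v * q).
    have [lq lvq] : len q = 1%N /\ len (v * q) = (len v).+1.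
      by apply: contrapT => nq; apply: noN; exists 0%N => m _ ? ?; case: nq.
    rewrite mulKg; split=> // N; apply: contrapT => noM; apply: noN; exists N.
    by move=> m Nm _ _ pm; apply: noM; exists m.
  (* Beyond every [N q] no neighbour is a prefix any more; the bound [(len v).+1] ensures
     [z m <> v], so a geodesic from [v] to [z m] has a first step [q]. *)
  have [m Nm vm] := Pv (maxn (\max_(q <- ball) N q) (len v).+1).
  have lz := zlong m.
  have [q [lq lqz]] : exists q, len q = 1%N /\
      len (q^-1 * (v^-1 * z m)) = (len (v^-1 * z m) - 1)%N.
    by apply: len_split; rewrite /prefix in vm; group_lia.
  have e : (v * q)^-1 * z m = q^-1 * (v^-1 * z m) by rewrite !gnorm.
  have := lenM (v * q) ((v * q)^-1 * z m); rewrite mulVKg e lqz => l1.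
  have := lenM v q; rewrite lq => l2; rewrite /prefix in vm.
  apply: (Nq q m); rewrite /prefix ?e ?lqz; try by group_lia.
  have qb : q \in ball by apply: ballP; rewrite lq.
  have : (N q <= \max_(q <- ball) N q)%N by apply: leq_bigmax_seq.
  by move: Nm; rewrite geq_max => /andP[NM _] /leq_trans; apply.
have [f fP] := choice step.
have rP i : P (iter i f 1) by elim: i => //= i /fP[].
have rS i : len ((iter i f 1)^-1 * iter i.+1 f 1) = 1%N by have [] := fP _ (rP i).
have lr i : len (iter i f 1) = i.
  elim: i => [|i IHi] /=; first exact: len1.
  by have [_ _ ->] := fP _ (rP i); rewrite IHi.
exists (fun i => iter i f 1); split=> [i j ij|i]; last first.
  by have [m _] := rP i 0%N; exists m.
apply/eqP; rewrite eqn_leq; apply/andP; split.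
  rewrite -(subnKC ij); elim: (j - i)%N => [|k IHk].
    by rewrite addn0 mulVg len1.
  have := lenM ((iter i f 1)^-1 * iter (i + k) f 1)
    ((iter (i + k) f 1)^-1 * iter (i + k).+1 f 1).
  rewrite -mulgA mulVKg rS -addnS; group_lia.
by have := len_mull_le (iter i f 1)^-1 (iter j f 1); rewrite lenV !lr; group_lia.
Qed.

(* A ping-pong criterion: every letter [l] points in its own direction [kap l]. *)
Section Schottky.
Variables (B : set G) (kap : bool * G -> G) (c1 c2 : nat).
Hypotheses
  (kap_sep : forall l l', B l.2 -> B l'.2 -> l <> l' ->
     (gp (kap l) (kap l') <= c1)%N)
  (kap_val : forall l, B l.2 ->
     ((len (kap l)).*2 <= gp (kap l) (letter_val l) + c2)%N)
  (kap_long : forall l, B l.2 -> (2 * c1 + c2 + 6 * D < len (kap l))%N).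

Lemma schottky_gp l l' : B l.2 -> B l'.2 -> l <> l' ->
  (gp (letter_val l) (letter_val l') <= c1 + 2 * D)%N.
Proof.
move=> Bl Bl' ll'.
have := kap_sep Bl Bl' ll'; have := kap_long Bl; have := kap_long Bl'.
have := kap_val Bl; have := kap_val Bl'.
have := gp_hyp (kap l) (letter_val l) (letter_val l').
have := gp_hyp (kap l) (letter_val l') (kap l').
rewrite [gp (letter_val l') _]gpC; group_lia.
Qed.

Lemma schottky_len l : B l.2 -> (2 * c1 + 6 * D < len (letter_val l))%N.
Proof.
move=> Bl; have := kap_long Bl; have := kap_val Bl.
have := gp_len (letter_val l) (kap l); rewrite gpC; group_lia.
Qed.

Lemma schottky_path l w : word_over B (l :: w) -> reduced (l :: w) ->
  path (fun y z => gp y^-1 z <= c1 + 2 * D)%N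
    (letter_val l) (map (@letter_val G) w).
Proof.
elim: w l => //= l' w IHw l /word_over_cons[Bl wB] /andP[ll' rw].
have [Bl' _] := word_over_cons wB.
rewrite IHw // andbT -letter_valV; apply: schottky_gp => // e.
by move: ll'; rewrite -e eqxx /=; case: (l.1).
Qed.

Lemma schottky_len_word w : word_over B w ->
  forall y, y \in map (@letter_val G) w -> (c1 + 2 * D + D < len y)%N.
Proof. by move=> wB y /mapP[l /wB/schottky_len Bl ->]; group_lia. Qed.

Lemma schottky_neq1 w : word_over B w -> reduced w -> word_val w = 1 -> w = [::].
Proof.
case: w => // l w wB rw; rewrite /word_val -(big_map _ xpredT id) => e.
by have := chain_neq1 (schottky_len_word wB) (schottky_path wB rw) e.
Qed.

(** A reduced word follows the direction of its first letter, which [z] leaves early. For [z]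
    running along a ray, this keeps the endpoint of the ray out of the limit set. *)
Lemma schottky_word_gp z w : (forall l, B l.2 -> (gp (kap l) z <= c1)%N) ->
  word_over B w -> reduced w -> (gp (word_val w) z <= c1 + 2 * D)%N.
Proof.
move=> kz; case: w => [|l w] wB rw; first by rewrite word_val_nil gp1.
have := chain_gp (schottky_len_word wB) (schottky_path wB rw).
rewrite -[_ :: map _ _]/(map (@letter_val G) (l :: w)) big_map -/(word_val _).
have [Bl _] := word_over_cons wB.
have := kz l Bl; have := schottky_len Bl; have := kap_val Bl; have := kap_long Bl.
have := gp_hyp (kap l) (letter_val l) z.
have := gp_hyp (letter_val l) (word_val (l :: w)) z; group_lia.
Qed.

End Schottky.

(* Ping-pong elements of the form [k1 * g * k2^-1], for [g] in a given list and
   [k1], [k2] in the cosets [<t> x <t>]. The directions are those of the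
   [t^(N j) x], with the final power of [t] in [k1] and [k2] long; its sign in
   [k2] is chosen so that no cancellation occurs around [g]. *)
Lemma exists_schottky t x C (gs : seq G) : (gp t^-1 t + 3 * D < len t)%N ->
  (forall m n, (gp (zpow t m) (x * zpow t n) <= C)%N) ->
  exists (hs : seq G) (kap : bool * G -> G) c1 c2, let B := [set` hs] in
  [/\ forall l l', B l.2 -> B l'.2 -> l <> l' -> (gp (kap l) (kap l') <= c1)%N,
      forall l, B l.2 -> ((len (kap l)).*2 <= gp (kap l) (letter_val l) + c2)%N,
      forall l, B l.2 -> (2 * c1 + c2 + 6 * D < len (kap l))%N,
      forall l k, B l.2 -> (gp (kap l) (zpow t k) <= c1)%N &
      forall g, g \in gs -> exists m1 m2 m3 m4,
        zpow t m1 * x * zpow t m2 * g * zpow t m3 * x^-1 * zpow t m4 \in hs].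
Proof.
move=> lox indep.
(* Distinct [T j] differ by a power of [t] longer than [C + D]; the [n.*2] indices give each [g] one
   [T] for either side. *)
pose n := size gs; pose g_ i := nth 1 gs i; pose N := (C + D + 1)%N.
pose T (j : nat) := zpow t (Posz (N * j)).
pose A := (N * n.*2 * len t)%N; pose Ga := \max_(g <- gs) len g.
have lT j : (j < n.*2)%N -> (len (T j) <= A)%N.
  move=> jn; apply: leq_trans (len_expg _ _) _.
  by rewrite leq_mul2r leq_mul2l (ltnW jn) !orbT.
pose c4 := (gp t^-1 t + 2 * Ga + 3 * D)%N.
pose c1 := (C + D + 2 * A)%N; pose c3 := (c4 + 4 * (len x + A) + 2 * Ga)%N.
pose M := (len x + A + 2 * c1 + c3 + 6 * D + 1)%N.
(* Detects that [t^-M] and [g * t^-M] run together, which would make [g] cancel; the power in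
   [k true] then gets the opposite sign. *)
pose flip g := ~~ (gp (zpow t (- Posz M)) (g * zpow t (- Posz M)) <= c4)%N.
pose e (b : bool) g : int := if b && flip g then (- Posz M)%R else Posz M.
pose k (b : bool) i := T (i.*2 + b)%N * (x * zpow t (e b (g_ i))).
pose h i := k false i * g_ i * (k true i)^-1.
have idx (b : bool) i : (i < n)%N -> (i.*2 + b < n.*2)%N.
  by case: b; group_lia.
have lgs i : (i < n)%N -> (len (g_ i) <= Ga)%N.
  by move=> il; apply: (@leq_bigmax_seq _ gs xpredT len) => //; apply: mem_nth.
have lze b g : len (zpow t (e b g)) = len (t ^+ M).
  by rewrite /e; case: ifP => _; rewrite ?zpowN ?lenV.
(* After removing [T i], the second element follows [t^d] for long and the first, by [indep], does
   not; putting [T i] back costs at most [2 * A]. *)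
have sepT i j m m' : (i < n.*2)%N -> (j < n.*2)%N -> i <> j ->
    (gp (T i * (x * zpow t m)) (T j * (x * zpow t m')) <= c1)%N.
  move=> ilt jlt ij; pose d := (Posz (N * j) - Posz (N * i))%R.
  have -> : T j * (x * zpow t m') = T i * (zpow t d * (x * zpow t m')).
    by rewrite [RHS]mulgA /T -zpowD; congr (zpow t _ * _); rewrite /d; lia.
  have := gp_mul2l (T i) (x * zpow t m) (zpow t d * (x * zpow t m')).
  have := lT i ilt.
  have ld : (C + D < len (zpow t d))%N.
    have [b ->] := zpow_sign t d.
    have : (C + D < absz d)%N.
      have lt a b' : (a < b')%N -> (N + N * a <= N * b')%N.
        by move=> ab; rewrite -mulnS leq_mul2l ab orbT.
      by rewrite /d; case: (ltngtP i j) ij => // /lt; rewrite /N; lia.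
    have := lox_len lox (absz d); case: b; rewrite ?len_expgV; group_lia.
  have := gp_mulV (zpow t d) (x * zpow t m'); rewrite -zpowN.
  have := indep (- d)%R m'; have := indep d m.
  have := gp_hyp (x * zpow t m) (zpow t d * (x * zpow t m')) (zpow t d).
  rewrite [gp _ (zpow t d)]gpC [gp (zpow t d * _) (zpow t d)]gpC /c1; group_lia.
have kinv (b : bool) i : (i < n)%N ->
    (len (x^-1 * (T (i.*2 + b)%N)^-1) <= len x + A)%N.
  move=> /(idx b)/lT; have := lenM x^-1 (T (i.*2 + b)%N)^-1.
  by rewrite !lenV; group_lia.
have kVE (b : bool) i : (k b i)^-1 =
    zpow t (- e b (g_ i))%R * (x^-1 * (T (i.*2 + b)%N)^-1).
  by rewrite /k zpowN !gnorm.
have klong b i : (i < n)%N -> (2 * c1 + c3 + 6 * D < len (k b i))%N.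
  move=> il; have := lox_len lox M; have := lze b (g_ i).
  have := len_mull_le (T (i.*2 + b)%N * x) (zpow t (e b (g_ i))).
  have := lenM (T (i.*2 + b)%N) x; have := lT _ (idx b i il).
  by rewrite -mulgA -/(k b i) /M; group_lia.
(* [g * t^M] and [g * t^-M] diverge, so at most one of them runs along [t^-M]. Passing to the [k]'s
   changes both arguments by at most [len x + A]. *)
have flat i : (i < n)%N ->
    (gp (k false i)^-1 (g_ i * (k true i)^-1) <= c4 + 4 * (len x + A))%N.
  move=> il; set g := g_ i.
  have : (gp (zpow t (- e false g)) (g * zpow t (- e true g)) <= c4)%N.
    rewrite /e /=; case: ifP => [/negP fl|/negbT]; last by rewrite negbK.
    rewrite GRing.opprK.
    have := gp_hyp (g * zpow t (Posz M)) (zpow t (- Posz M))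
      (g * zpow t (- Posz M)).
    have := gp_mul2l g (zpow t (Posz M)) (zpow t (- Posz M)).
    have := lgs i il; rewrite -/g zpowN /= [gp (t ^+ M) _]gpC.
    have := lox_gpV lox M M; move/negP: fl; rewrite -ltnNge zpowN /=.
    rewrite [gp (g * _) (t ^- M)]gpC /c4; group_lia.
  have := gp_mulr (zpow t (- e false g)) (g * (k true i)^-1)
    (x^-1 * (T (i.*2 + false)%N)^-1).
  rewrite -kVE; have := kinv false i il; have := kinv true i il.
  have := gp_mulr (g * zpow t (- e true g)) (zpow t (- e false g))
    (x^-1 * (T (i.*2 + true)%N)^-1).
  rewrite -[g * _ * _]mulgA -kVE [gp (g * (k _ _)^-1) _]gpC.
  rewrite [gp (g * zpow t _) _]gpC.
  group_lia.
(* [h i] starts along [k false i] and its inverse along [k true i], so the sign of the letter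
   selects the direction. *)
exists (mkseq h n), (fun l => k l.1 (index l.2 (mkseq h n))), c1, c3.
have hB y : [set` mkseq h n] y ->
    (index y (mkseq h n) < n)%N /\ h (index y (mkseq h n)) = y.
  move=> /= yh; have il : (index y (mkseq h n) < n)%N.
    by rewrite -{2}(size_mkseq h n) index_mem.
  by split=> //; rewrite -(nth_mkseq 1 h il) nth_index.
split.
- move=> [b y] [b' y'] /hB[/= il hy] /hB[/= il' hy'] ll'.
  apply: sepT; [exact: idx | exact: idx | move=> ii; apply: ll'].
  have [-> ib] : b = b' /\ index y (mkseq h n) = index y' (mkseq h n).
    by move: ii; case: (b); case: (b') => /= ii; split=> //; lia.
  by rewrite -hy ib hy'.
- move=> [b y] /hB[/=]; set i := index _ _ => il hy.
  have fl := flat i il; have lg := lgs i il.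
  case: b; rewrite /letter_val /= -hy.
    have -> : (h i)^-1 = k true i * ((g_ i)^-1 * (k false i)^-1).
      by rewrite /h !gnorm.
    have := gp_mulV (k true i) ((g_ i)^-1 * (k false i)^-1).
    have := gp_mul2l_ge (g_ i) (k true i)^-1 ((g_ i)^-1 * (k false i)^-1).
    rewrite mulVKg [gp (_ * _) (k false i)^-1]gpC /c3; group_lia.
  have -> : h i = k false i * (g_ i * (k true i)^-1) by rewrite /h mulgA.
  by have := gp_mulV (k false i) (g_ i * (k true i)^-1); rewrite /c3; group_lia.
- by move=> [b y] /hB[/= il _]; apply: klong.
- move=> [b y] m /hB[/=]; set i := index _ _ => il _.
  pose j := (i.*2 + b)%N.
  have -> : zpow t m = T j * zpow t (m - Posz (N * j))%R.
    rewrite /T -zpowD; congr zpow; lia.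
  rewrite /k -/j; have := lT j (idx b i il).
  have := gp_mul2l (T j) (x * zpow t (e b (g_ i)))
    (zpow t (m - Posz (N * j))%R).
  have := indep (m - Posz (N * j))%R (e b (g_ i)).
  rewrite [gp (x * _) (zpow _ _)]gpC /c1; group_lia.
- move=> g ggs; have il : (index g gs < n)%N by rewrite index_mem.
  exists (Posz (N * ((index g gs).*2 + false))), (e false g).
  exists (- e true g)%R, (- Posz (N * ((index g gs).*2 + true)))%R.
  apply/mapP; exists (index g gs); first by rewrite mem_iota.
  by rewrite /h kVE /k /g_ nth_index // !zpowN /T !gnorm.
Qed.

End HyperbolicLength.

(** * The finite residual *)

Section FreeReduction.
Variable G : groupType.

Lemma reduced_word_val (B : set G) w : word_over B w ->
  exists w', [/\ word_over B w', reduced w' & word_val w' = word_val w].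
Proof.
elim: w => [|l w IHw] wB; first by exists [::].
have [Bl /IHw[w' [wB' rw' e]]] := word_over_cons wB; rewrite word_val_cons -e.
case: w' => [|a w'] in wB' rw' e *.
  by exists [:: l]; rewrite word_val_cons; split=> // l'; rewrite inE => /eqP->.
have [la|la] := boolP ((l.2 == a.2) && (l.1 != a.1)); last first.
  exists (l :: a :: w'); rewrite word_val_cons; split=> //; last first.
    by rewrite /reduced /= la.
  by move=> l'; rewrite inE => /orP[/eqP->|/wB'].
have -> : l = letter_inv a.
  by case: l a la {wB Bl wB' rw' e} => [[] y] [[] z] //= /andP[/eqP->].
have [_ wB''] := word_over_cons wB'.
exists w'; rewrite word_val_cons letter_valV mulKg; split=> //.
exact: path_sorted rw'.
Qed.

End FreeReduction.

Section FiniteResidual.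
Variable G : groupType.

(** The subgroup [K] generated by [t^2] has finite index, and misses [t] because [t^(2m) = t] would
    make [t] torsion, [2m - 1] being odd and hence nonzero. *)
Lemma finite_residual_cofinite (t : G) (ys : seq G) :
  (forall n, (0 < n)%N -> t ^+ n <> 1) ->
  (forall g, exists m y, y \in ys /\ g = zpow t m * y) ->
  ~ @finite_residual G t.
Proof.
move=> tn1 ysP; pose K := range (fun m => zpow t (2 * m)%R).
move=> /(_ K)[|m _ tm].
  split.
    split=> [|_ _ [m _ <-] [n _ <-]]; first by exists 0%R.
    by exists (m - n)%R; rewrite // -zpowB; congr zpow; lia.
  have sub m : [set zpow t (2 * m)%R * k | k in K] = K.
    apply/seteqP; split=> [_ [_ [n _ <-] <-]|_ [n _ <-]].
      by exists (m + n)%R; rewrite // -zpowD; congr zpow; lia.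
    exists (zpow t (2 * (n - m))%R); first by exists (n - m)%R.
    by rewrite -zpowD; congr zpow; lia.
  (* By the parity of the exponent of [t] in [g], the coset of [g] is that of [y^-1] or of
     [y^-1 * t]; [ysP] is applied to [g^-1] to bring the power of [t] to the right. *)
  apply: (@sub_finite_set _ _ ((fun u => [set u * k | k in K]) @`
      [set` [seq y^-1 | y <- ys] ++ [seq y^-1 * t | y <- ys]])); last first.
    exact/finite_image/finite_seq.
  move=> _ [g _ <-]; have [m [y [yys gy]]] := ysP g^-1.
  have eg : g = y^-1 * zpow t (- m)%R by rewrite zpowN -invgM -gy invgK.
  have cosetM u v :
      [set u * v * k | k in K] = [set u * k | k in [set v * k | k in K]].
    by rewrite image_comp; congr image; apply/funext => k /=; rewrite mulgA.
  pose q := (- m %/ 2)%Z.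
  have [mq|mq] : (- m = 2 * q)%R \/ (- m = 1 + 2 * q)%R by rewrite /q; lia.
    exists y^-1; first by rewrite /= mem_cat map_f.
    by rewrite eg mq cosetM sub.
  exists (y^-1 * t).
      by rewrite /= mem_cat; apply/orP; right; apply/mapP; exists y.
  by rewrite eg mq zpowD mulgA [in RHS]cosetM sub.
have [b e] := zpow_sign t (2 * m - 1)%R.
apply: (tn1 (absz (2 * m - 1)%R)); first lia.
have : zpow t (2 * m - 1)%R = 1 by rewrite zpowB tm /= mulgV.
by rewrite e; case: b {e} => //; rewrite expVgn => /(canRL invgK); rewrite invg1.
Qed.

Lemma torsion_free_finite_subgroup (H : set G) :
  torsion_free G -> subgroup H -> finite_set H -> H = [set 1].
Proof.
move=> tf sH /finite_seqP[s Hs]; apply/seteqP; split=> [x Hx|_ ->]; last by case: sH.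
have : ~~ uniq [seq x ^+ i | i <- iota 0 (size s).+1].
  apply/negP => us.
  have : (size [seq x ^+ i | i <- iota 0 (size s).+1] <= size s)%N.
    apply: uniq_leq_size => // y /mapP[i _ ->].
    by have := subgroupX i sH Hx; rewrite Hs.
  by rewrite size_map size_iota ltnn.
move/(uniqPn 1) => [i [j [ij]]]; rewrite size_map size_iota => js.
rewrite !(nth_map 0%N) ?size_iota ?(ltn_trans ij js) //.
rewrite !nth_iota ?(ltn_trans ij js) // !add0n => e.
apply: (tf x (j - i)%N); first by rewrite subn_gt0.
by rewrite expgnFr ?(ltnW ij) // -e mulgV.
Qed.

End FiniteResidual.

(** * The engulfing argument *)

Section Main.
Variables (G : groupType) (S : set G).
Hypothesis hG : word_hyperbolic S.
Hypothesis hengulf : forall H : set G, subgroup H -> finitely_generated H ->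
  free_subgroup H -> limit_set S H `<` boundary S -> engulfed H.

Lemma finite_residual_finite : finite_set (@finite_residual G).
Proof.
have [finS genS _] := hG; have [D hl] := word_hyperbolic_length hG.
apply: contrapT => infR; have sR := subgroup_finite_residual G.
have nR := @finite_residual_conj G.
have [t Rt lox] := exists_lox hl sR nR infR.
have [[x [C indep]]|[ys ysP]] :=
  lox_independent_or_cofinite hl lox; last first.
  apply: finite_residual_cofinite ysP Rt => n n0.
  rewrite -(expg0 t) => /(lox_expg_inj hl lox); lia.
have /finite_seqP[gs Sgs] := finS.
have [hs [kap [c1 [c2 [sep kval klong kt hsP]]]]] :=
  exists_schottky hl gs lox indep.
set B := [set` hs] in sep kval klong kt.
have [r [rgeo rt]] := geodesic_limit hl
  (lox_len hl lox).
(* Each [r n] lies on a geodesic from 1 to some [t ^+ m], so the bound for powers of [t] passes to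
   it. *)
have Rray n l : B l.2 -> (gp (word_length S) (kap l) (r n) <= c1)%N.
  move=> Bl; have [m rm] := rt n; rewrite (gpC hl).
  apply: leq_trans (gp_prefix hl _ rm) _; rewrite (gpC hl).
  exact: (kt l (Posz m)).
have [K [sK fK [_ Kproper] HK]] : engulfed (gen B).
  apply: hengulf; first exact: subgroup_gen.
  - by exists B => //; apply: finite_seq.
  - exists B; split=> // w; exact: (schottky_neq1 hl sep kval klong).
  (* The class of [r] is a boundary point but no limit of [gen B]: along [r], reduced words over [B]
     have [gp] at most [c1 + 2 * D]. *)
  split=> [xi []//|bl].
  have Cr : ray_class S r r.
    split=> [i j ij|]; first by rewrite /word_dist rgeo.
    by exists 0%N => i; rewrite /word_dist mulVg (len1 hl).
  have [_ [u uH uconv]] : limit_set S (gen B) (ray_class S r).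
    by apply: bl; exists r => //; case: Cr.
  have [N /(_ N N (leqnn N) (leqnn N))] := uconv r Cr (c1 + 2 * D + 1)%:R%R.
  have [w wB <-] := uH N; have [w' [wB' rw' <-]] := reduced_word_val wB.
  have := schottky_word_gp hl sep kval klong (Rray N) wB' rw'.
  rewrite -(Num.Theory.ler_nat rat) -gromov_product_gp // !GRing.natrD.
  have := Num.Theory.ler0n rat c1; have := Num.Theory.ler0n rat (2 * D); lra.
have RK : @finite_residual G `<=` K by move=> y Ry; apply: Ry; split.
apply: Kproper => z _.
have tK m : K (zpow t m) by exact: subgroup_zpow sK (RK _ Rt).
have xK m : K (x * zpow t m * x^-1).
  by apply: RK; apply: nR; exact: subgroup_zpow sR Rt.
(* [x^-1 K x] is a subgroup; once it contains [S] it is all of [G], and hence so is [K]. *)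
suff : gen S `<=` [set y | K (x * y * x^-1)].
  rewrite genS => /(_ (x^-1 * z * x) I) /=; by rewrite !gnorm.
apply: gen_sub; first exact: subgroup_preconj.
move=> g Sg /=; have [m1 [m2 [m3 [m4 hB]]]] : exists m1 m2 m3 m4,
    zpow t m1 * x * zpow t m2 * g * zpow t m3 * x^-1 * zpow t m4 \in hs.
  by apply: hsP; move: Sg; rewrite Sgs.
have hK := HK _ (@sub_gen _ B _ hB).
(* The middle factor comes from the basis element, stripped of its outer powers of [t]; the outer
   factors are conjugates of powers of [t], in [K] because the finite residual is normal. *)
have -> : x * g * x^-1 = (x * zpow t (- m2)%R * x^-1) * (zpow t (- m1)%R *
  (zpow t m1 * x * zpow t m2 * g * zpow t m3 * x^-1 * zpow t m4) *
  zpow t (- m4)%R) * (x * zpow t (- m3)%R * x^-1).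
  by rewrite !zpowN !gnorm.
by do !apply: subgroupM => //.
Qed.

End Main.

Theorem theorem4p1 (G : groupType) (S : set G) (hG : word_hyperbolic S)
  (hengulf : forall H : set G, subgroup H -> finitely_generated H ->
     free_subgroup H -> limit_set S H `<` boundary S -> engulfed H) :
  almost_residually_finite G /\ (torsion_free G -> residually_finite G).
Proof.
have finR := finite_residual_finite hG hengulf; split=> // tf.
exact: torsion_free_finite_subgroup tf (subgroup_finite_residual G) finR.
Qed.
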